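(* Let $(\Omega,\Sigma,\mathbb{P})$ be a probability space and let $X$ be an ideal of $L_0(\Sigma)$ which contains the constant functions and admits a strictly positive order continuous linear functional. Let $f\in X$ with $f\ge 0$, and let $O_f=\operatorname{span}\{\mathbb 1,(f-k)^+:k\in\mathbb{R}\}$. For $g\in X$, the following are equivalent: (a) $g\in L_0(\sigma(f))\cap X$; (b) $g$ belongs to the closure of $O_f$ in the $\sigma(X,X_n^\sim)$-topology; (c) there exists a sequence $(g_n)$ in $O_f$ such that $g_n\to g$ almost everywhere.
   Context: $L_0(\Sigma)$ is the vector lattice of real-valued measurable functions modulo a.e. equality with the a.e. order; an ideal is a subspace $X$ with $|x|\le|y|$, $y\in X$ implying $x\in X$. $\mathbb 1$ is the constant one function. A net $x_\alpha$ converges in order to $x$ in $X$ if there is a net $z_\beta\downarrow 0$ in $X$ such that for every $\beta$ there is $\alpha_0$ with $|x_\alpha-x|\le z_\beta$ for $\alpha\ge\alpha_0$. A linear functional $\phi$ on $X$ is order continuous if $\phi(x_\alpha)\to 0$ whenever $x_\alpha\to 0$ in order in $X$; it is strictly positive if $\phi(x)>0$ whenever $x\ge0$, $x\neq 0$. $X_n^\sim$ denotes the space of all order continuous linear functionals on $X$, and $\sigma(X,X_n^\sim)$ is the weak topology on $X$ induced by $X_n^\sim$. $\sigma(f)$ is the smallest sub-$\sigma$-algebra of $\Sigma$ making $f$ measurable and containing all $\mathbb{P}$-null sets; $L_0(\sigma(f))$ is the set of functions in $L_0(\Sigma)$ measurable with respect to $\sigma(f)$. *)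

(* Defs.v *)
From HB Require Import structures.
From mathcomp Require Import all_boot all_order all_algebra.
From mathcomp Require Import all_classical all_reals all_analysis.
Set Implicit Arguments. Unset Strict Implicit. Unset Printing Implicit Defensive.
Import Order.TTheory GRing.Theory Num.Theory.
Import numFieldNormedType.Exports.
Local Open Scope classical_set_scope.
Local Open Scope ring_scope.

Section Defs.
Context (d : measure_display) (T : measurableType d) (R : realType)
        (P : probability T R).

(* Elements of L_0(Sigma) are represented by measurable functions T -> R;
   equality/order are taken almost everywhere. *)
Definition L0 : set (T -> R) := [set g | measurable_fun setT g].

(* An ideal of L_0(Sigma): a linear subspace, solid w.r.t. the a.e. order
   (solidity also makes it saturated under a.e. equality). *)
Definition is_ideal (X : set (T -> R)) : Prop :=
  [/\ X `<=` L0,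
      X (fun _ => 0),
      (forall x y, X x -> X y -> X (fun t => x t + y t)),
      (forall (a : R) x, X x -> X (fun t => a * x t)) &
      (forall x y, X y -> L0 x -> {ae P, forall t, `|x t| <= `|y t|} -> X x)].

Definition directed (A : Type) (le : A -> A -> Prop) : Prop :=
  [/\ inhabited A, (forall a, le a a),
      (forall a b c, le a b -> le b c -> le a c) &
      (forall a b, exists c, le a c /\ le b c)].

Definition decr_to_zero (X : set (T -> R)) (B : Type) (leB : B -> B -> Prop)
  (z : B -> T -> R) : Prop :=
  [/\ (forall b, X (z b)),
      (forall b b', leB b b' -> {ae P, forall t, z b' t <= z b t}),
      (forall b, {ae P, forall t, 0 <= z b t}) &
      (forall w, X w -> (forall b, {ae P, forall t, w t <= z b t}) ->
                 {ae P, forall t, w t <= 0})].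

Definition order_cvg (X : set (T -> R)) (A : Type) (le : A -> A -> Prop)
  (xs : A -> T -> R) (x : T -> R) : Prop :=
  exists (B : Type) (leB : B -> B -> Prop) (z : B -> T -> R),
    [/\ directed leB, decr_to_zero X leB z &
        forall b, exists a0, forall a, le a0 a ->
          {ae P, forall t, `|xs a t - x t| <= z b t}].

Definition lin_functional (X : set (T -> R)) (phi : (T -> R) -> R) : Prop :=
  (forall x y, X x -> X y -> {ae P, forall t, x t = y t} -> phi x = phi y) /\
  (forall (a : R) x y, X x -> X y -> phi (fun t => a * x t + y t) = a * phi x + phi y).

Definition order_continuous (X : set (T -> R)) (phi : (T -> R) -> R) : Prop :=
  forall (A : Type) (le : A -> A -> Prop) (xs : A -> T -> R),
    directed le -> (forall a, X (xs a)) -> order_cvg X le xs (fun _ => 0) ->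
    forall e : R, 0 < e -> exists a0, forall a, le a0 a -> `|phi (xs a)| < e.

Definition in_Xn (X : set (T -> R)) (phi : (T -> R) -> R) : Prop :=
  lin_functional X phi /\ order_continuous X phi.

Definition strictly_positive (X : set (T -> R)) (phi : (T -> R) -> R) : Prop :=
  forall x, X x -> {ae P, forall t, 0 <= x t} -> ~ {ae P, forall t, x t = 0} ->
    0 < phi x.

Definition weak_closure (X : set (T -> R)) (S : set (T -> R)) (g : T -> R) : Prop :=
  X g /\ forall (phis : seq ((T -> R) -> R)) (e : R),
    (forall phi, phi \in phis -> in_Xn X phi) -> 0 < e ->
    exists h, S h /\ forall phi, phi \in phis -> `|phi g - phi h| < e.

Definition Of (f : T -> R) : set (T -> R) :=
  [set h | exists (c0 : R) (s : seq (R * R)), forall t,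
     h t = c0 + \sum_(p <- s) p.1 * Num.max (f t - p.2) 0].

Definition sigma_f (f : T -> R) : set (set T) :=
  <<s [set A | (exists B : set R, measurable B /\ A = f @^-1` B)
              \/ (measurable A /\ P A = 0%E)] >>.

Definition sigma_f_measurable (f g : T -> R) : Prop :=
  forall B : set R, measurable B -> sigma_f f (g @^-1` B).

End Defs.

(* Main.v *)
(* (a) => (b): an order continuous functional that annihilates O_f vanishes on
   the indicators of the sets [f > a], hence by the pi-lambda theorem on those of
   all sets of sigma(f), hence on every sigma(f)-measurable element of X. Finitely
   many functionals can therefore be interpolated exactly at g by an h in O_f.
   (b) => (c): if phi is strictly positive, every linear functional dominated by
   the seminorm p x = phi |x| is order continuous, so by Hahn-Banach a point of
   the weak closure of O_f is a p-limit of elements of O_f, and p-convergence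
   with summable rate implies convergence almost everywhere.
   (c) => (a): elements of O_f are sigma(f)-measurable and sigma(f) contains the
   measurable null sets. *)

Require Import Defs.
From HB Require Import structures.
From mathcomp Require Import all_boot all_order all_algebra.
From mathcomp Require Import all_classical all_reals all_analysis.
From mathcomp Require Import measurable_realfun ring lra.
Import Order.TTheory GRing.Theory Num.Theory.
Import numFieldNormedType.Exports.
Local Open Scope classical_set_scope.
Local Open Scope ring_scope.

(** * The Hahn-Banach theorem *)

Section HahnBanach.
Set Implicit Arguments.
Unset Strict Implicit.
Context (R : realType) (V : lmodType R).
Implicit Types (X S : set V) (p q : V -> R) (K : set (V * R)).

Definition subspace X := X 0 /\ forall (a : R) x y, X x -> X y -> X (a *: x + y).

(** [q] is a total function constrained only on [X]. Scaling is asked only as an inequality, which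
    is easier to check for infima; applying it to the inverse scalar gives equality. *)
Definition sublinear X q :=
  [/\ q 0 = 0,
      (forall (a : R) x, 0 < a -> X x -> q (a *: x) <= a * q x) &
      (forall x y, X x -> X y -> q (x + y) <= q x + q y)].

Lemma subspaceD X x y : subspace X -> X x -> X y -> X (x + y).
Proof. by move=> [_ XL] Xx Xy; rewrite -[x]scale1r; exact: XL. Qed.

Lemma subspaceZ X (a : R) x : subspace X -> X x -> X (a *: x).
Proof. by move=> [X0 XL] Xx; rewrite -[_ *: _]addr0; exact: XL. Qed.

Lemma subspaceN X x : subspace X -> X x -> X (- x).
Proof. by move=> sX Xx; rewrite -scaleN1r; exact: subspaceZ. Qed.

Lemma subspaceB X x y : subspace X -> X x -> X y -> X (x - y).
Proof. by move=> sX Xx Xy; apply: subspaceD => //; exact: subspaceN. Qed.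

Lemma sublinear_ge X q x : subspace X -> sublinear X q -> X x ->
  - q (- x) <= q x.
Proof.
move=> sX [q0 _ qD] Xx; rewrite lerNl -subr_ge0 opprK -q0 -(subrr x).
by rewrite [leRHS]addrC; apply: qD => //; exact: subspaceN.
Qed.

Lemma sublinearZ X q (a : R) x : subspace X -> sublinear X q -> 0 <= a ->
  X x -> q (a *: x) = a * q x.
Proof.
move=> sX [q0 qZ _]; rewrite le_eqVlt => /predU1P[<-|a0] Xx.
  by rewrite scale0r mul0r.
apply/eqP; rewrite eq_le qZ//= -ler_pdivlMl//.
rewrite -{1}[x](scalerK (lt0r_neq0 a0)).
by apply: qZ; [rewrite invr_gt0|exact: subspaceZ].
Qed.

(** [r x] is the infimum of [q (x + k.1) - k.2] over the cone. A linear functional below [r] is then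
    at least [k.2] at [k.1]. *)
Lemma sublinear_cone X q K : subspace X -> sublinear X q ->
  K (0, 0) -> (forall k l, K k -> K l -> K (k.1 + l.1, k.2 + l.2)) ->
  (forall (a : R) k, 0 < a -> K k -> K (a *: k.1, a * k.2)) ->
  (forall k, K k -> X k.1 /\ k.2 <= q k.1) ->
  exists r, [/\ sublinear X r, (forall x, X x -> r x <= q x) &
    forall k, K k -> r (- k.1) <= - k.2].
Proof.
move=> sX slq K0 KD KZ Kq; have [q0 qZ qD] := slq.
pose E x := [set q (x + k.1) - k.2 | k in K].
have E0 x : E x !=set0 by exists (q (x + 0) - 0), (0, 0).
(* Finiteness of the infimum: [k.2 <= q k.1] and subadditivity bound it below, uniformly in [k]. *)
have lbE x : X x -> lbound (E x) (- q (- x)).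
  move=> Xx _ [k /Kq[Xk kq] <-]; rewrite lerBrDr.
  have : q k.1 <= q (x + k.1) + q (- x).
    rewrite -{1}[k.1](addKr x) [leRHS]addrC.
    by apply: qD; [exact: subspaceN|exact: subspaceD].
  by move: kq; lra.
have Einf x k : X x -> K k -> inf (E x) <= q (x + k.1) - k.2.
  by move=> Xx Kk; apply: ge_inf; [exists (- q (- x)); exact: lbE|exists k].
exists (fun x => inf (E x)); split.
- split.
  + apply/eqP; rewrite eq_le; apply/andP; split.
      by have := Einf 0 (0, 0) sX.1 K0; rewrite /= addr0 subr0 q0.
    by have := lb_le_inf (E0 0) (lbE 0 sX.1); rewrite oppr0 q0 oppr0.
  + move=> a x a0 Xx; rewrite -ler_pdivrMl//.
    apply: lb_le_inf => // _ [k Kk <-]; rewrite ler_pdivrMl//.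
    have := Einf (a *: x) _ (subspaceZ _ sX Xx) (KZ _ _ a0 Kk).
    rewrite /= -scalerDr => /le_trans; apply; rewrite mulrBr lerD2r.
    by apply: qZ => //; apply: subspaceD => //; exact: (Kq _ Kk).1.
  + move=> x y Xx Xy; rewrite -lerBlDl.
    apply: lb_le_inf => // _ [l Kl <-]; rewrite lerBlDl -lerBlDr.
    apply: lb_le_inf => // _ [k Kk <-]; rewrite lerBlDr.
    have := Einf _ _ (subspaceD sX Xx Xy) (KD _ _ Kk Kl) => /= /le_trans; apply.
    have := qD _ _ (subspaceD sX Xx (Kq _ Kk).1) (subspaceD sX Xy (Kq _ Kl).1).
    by rewrite (addrACA x); lra.
- by move=> x Xx; have := Einf x _ Xx K0; rewrite /= addr0 subr0.
- move=> k Kk; have := Einf (- k.1) k (subspaceN sX (Kq _ Kk).1) Kk.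
  by rewrite addNr q0 sub0r.
Qed.

(** Zorn's lemma: the pointwise infimum of a nonempty chain is again sublinear and dominated by
    [p]. *)
Lemma minimal_sublinear X p : subspace X -> sublinear X p ->
  exists q, [/\ sublinear X q, (forall x, X x -> q x <= p x) &
    forall r, sublinear X r -> (forall x, X x -> r x <= q x) ->
      forall x, X x -> q x <= r x].
Proof.
move=> sX slp.
pose U := {q : V -> R | sublinear X q /\ forall x, X x -> q x <= p x}.
(* The order is reversed, so that maximal elements are minimal functionals; it is only a preorder
   because values off [X] are ignored. *)
pose below (q r : U) := `[< forall x, X x -> sval r x <= sval q x >].
have p0 : U by exists p.
have [//|||q qmin] := @ZL_preorder U p0 below.
- by move=> q; apply/asboolP.
- move=> q r s /asboolP rq /asboolP qs; apply/asboolP => x Xx.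
  exact: le_trans (qs _ Xx) (rq _ Xx).
- move=> A Atot; have [[q0 Aq0]|noA] := pselect (A !=set0); last first.
    by exists p0 => s As; case: noA; exists s.
  pose E x := [set sval q x | q in A].
  have E0 x : E x !=set0 by exists (sval q0 x), q0.
  (* Every member is comparable with the fixed [q0], which yields one lower bound for the whole
     chain. *)
  have lbE x : X x -> lbound (E x) (- sval q0 (- x)).
    move=> Xx _ [q Aq <-]; have XNx := subspaceN sX Xx.
    have slq := (proj2_sig q).1; have slq0 := (proj2_sig q0).1.
    have [/asboolP h|/asboolP h] := Atot _ _ Aq Aq0.
      exact: le_trans (sublinear_ge sX slq0 Xx) (h _ Xx).
    by apply: le_trans (sublinear_ge sX slq Xx); rewrite lerN2 h.
  have Einf x (q : U) : X x -> A q -> inf (E x) <= sval q x.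
    move=> Xx Aq; apply: ge_inf; last by exists q.
    by exists (- sval q0 (- x)); exact: lbE.
  have slm : sublinear X (fun x => inf (E x)) /\
      (forall x, X x -> inf (E x) <= p x).
    split; last first.
      by move=> x Xx; apply: le_trans (Einf x _ Xx Aq0) ((proj2_sig q0).2 x Xx).
    split.
    + have [q00 _ _] := (proj2_sig q0).1.
      apply/eqP; rewrite eq_le -{1}q00 Einf//=; last exact: sX.1.
      by have := lb_le_inf (E0 0) (lbE 0 sX.1); rewrite oppr0 q00 oppr0.
    + move=> a x a0 Xx; rewrite -ler_pdivrMl//.
      apply: lb_le_inf => // _ [q Aq <-]; rewrite ler_pdivrMl//.
      have [_ qZ _] := (proj2_sig q).1.
      exact: le_trans (Einf _ _ (subspaceZ _ sX Xx) Aq) (qZ _ _ a0 Xx).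
    + move=> x y Xx Xy; rewrite -lerBlDl.
      apply: lb_le_inf => // _ [q Aq <-]; rewrite lerBlDl -lerBlDr.
      apply: lb_le_inf => // _ [r Ar <-]; rewrite lerBlDr.
      have XD := subspaceD sX Xx Xy.
      (* The smaller of the two members can be used at both points, where its own subadditivity
         concludes. *)
      have [/asboolP h|/asboolP h] := Atot _ _ Aq Ar.
        have [_ _ rD] := (proj2_sig r).1.
        apply: le_trans (Einf _ _ XD Ar) (le_trans (rD _ _ Xx Xy) _).
        by rewrite lerD2l h.
      have [_ _ qD] := (proj2_sig q).1.
      apply: le_trans (Einf _ _ XD Aq) (le_trans (qD _ _ Xx Xy) _).
      by rewrite lerD2r h.
  exists (exist _ (fun x => inf (E x)) slm : U) => q Aq.
  by apply/asboolP => x Xx; exact: Einf.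
- exists (sval q); have [slq qp] := proj2_sig q; split=> // r slr rq x Xx.
  have rp : sublinear X r /\ forall y, X y -> r y <= p y.
    by split=> // y Xy; exact: le_trans (rq _ Xy) (qp _ Xy).
  have /qmin/asboolP : below q (exist _ r rp : U) by apply/asboolP.
  exact.
Qed.

(* A minimal sublinear functional is odd: lowering it along the ray through [g]
   yields a sublinear functional whose value at [- g] is at most [- q g]. *)
Lemma minimal_sublinear_linear X q : subspace X -> sublinear X q ->
  (forall r, sublinear X r -> (forall x, X x -> r x <= q x) ->
      forall x, X x -> q x <= r x) ->
  forall (a : R) x y, X x -> X y -> q (a *: x + y) = a * q x + q y.
Proof.
move=> sX slq qmin; have [q0 qZ qD] := slq.
have qN g : X g -> q (- g) = - q g.
  move=> Xg; apply/eqP; rewrite eq_le; apply/andP; split; last first.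
    by rewrite lerNl; exact: (sublinear_ge sX).
  pose K := [set (t *: g, t * q g) | t in [set t : R | 0 <= t]].
  have [||||r [slr rq rK]] := @sublinear_cone X q K sX slq.
  - by exists 0 => /=; rewrite ?scale0r ?mul0r.
  - move=> _ _ [s s0 <-] [t t0 <-] /=; exists (s + t); first exact: addr_ge0.
    by rewrite scalerDl mulrDl.
  - move=> a _ a0 [t t0 <-] /=; exists (a * t); first exact: mulr_ge0 (ltW a0) t0.
    by rewrite scalerA mulrA.
  - by move=> _ [t t0 <-] /=; rewrite (sublinearZ sX slq)//; split=> //; exact: subspaceZ.
  apply: le_trans (qmin _ slr rq _ (subspaceN sX Xg)) _.
  have /rK : K (g, q g) by exists 1 => /=; rewrite ?scale1r ?mul1r.
  exact.
have qadd x y : X x -> X y -> q (x + y) = q x + q y.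
  move=> Xx Xy; apply/eqP; rewrite eq_le qD//=.
  have := qD _ _ (subspaceD sX Xx Xy) (subspaceN sX Xy).
  by rewrite addrK qN//; lra.
move=> a x y Xx Xy; rewrite qadd//; last exact: subspaceZ.
congr (_ + _); have [a0|a0] := leP 0 a; first exact: sublinearZ slq a0 Xx.
have Na : 0 <= - a by rewrite oppr_ge0 ltW.
rewrite -[in LHS](opprK a) scaleNr qN; last exact: subspaceZ.
by rewrite (sublinearZ sX slq)// mulNr opprK.
Qed.

(** A minimal sublinear functional below the lowered [r] is linear; oddness turns its upper bound at
    [- k.1] into the lower bound at [k.1]. *)
Theorem hahn_banach_cone X p K : subspace X -> sublinear X p ->
  K (0, 0) -> (forall k l, K k -> K l -> K (k.1 + l.1, k.2 + l.2)) ->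
  (forall (a : R) k, 0 < a -> K k -> K (a *: k.1, a * k.2)) ->
  (forall k, K k -> X k.1 /\ k.2 <= p k.1) ->
  exists l : V -> R, [/\
    (forall (a : R) x y, X x -> X y -> l (a *: x + y) = a * l x + l y),
    (forall x, X x -> l x <= p x) & forall k, K k -> k.2 <= l k.1].
Proof.
move=> sX slp K0 KD KZ Kp.
have [r [slr rp rK]] := sublinear_cone sX slp K0 KD KZ Kp.
have [q [slq qr qmin]] := minimal_sublinear sX slr.
have qlin := minimal_sublinear_linear sX slq qmin.
exists q; split=> //; first by move=> x Xx; exact: le_trans (qr _ Xx) (rp _ Xx).
move=> k Kk; have Xk := (Kp _ Kk).1; have XNk := subspaceN sX Xk.
rewrite -lerN2; apply: le_trans (rK _ Kk); apply: le_trans (qr _ XNk).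
have [q0 _ _] := slq; have := qlin (-1) k.1 0 Xk sX.1.
by rewrite scaleN1r addr0 mulN1r q0 addr0 => ->.
Qed.

(* A linear functional dominated by [p] annihilates [S] and is positive at [g]
   as soon as it is at least [t d] at [h + t g] for all [h] in [S], [t >= 0]. *)
Corollary hahn_banach_separation X p S g (d : R) : subspace X -> sublinear X p ->
  subspace S -> S `<=` X -> X g -> 0 < d ->
  (forall x, X x -> 0 <= p x) ->
  (forall h, S h -> d <= p (g - h)) ->
  exists l : V -> R, [/\
    (forall (a : R) x y, X x -> X y -> l (a *: x + y) = a * l x + l y),
    (forall x, X x -> l x <= p x), (forall h, S h -> l h = 0) & 0 < l g].
Proof.
move=> sX slp sS SX Xg d0 p0 dp.
pose K := [set k : V * R | exists2 h, S h & exists2 t : R, 0 <= t &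
  k = (h + t *: g, t * d)].
have [||||l [llin lp lK]] := @hahn_banach_cone X p K sX slp.
- exists 0; first exact: sS.1.
  by exists 0 => //; rewrite scale0r mul0r addr0.
- move=> _ _ [h Sh [s s0 ->]] [k Sk [t t0 ->]] /=.
  exists (h + k); first exact: subspaceD.
  exists (s + t); first exact: addr_ge0.
  by rewrite scalerDl mulrDl addrACA.
- move=> a _ a0 [h Sh [t t0 ->]] /=; exists (a *: h); first exact: subspaceZ.
  exists (a * t); first exact: mulr_ge0 (ltW a0) t0.
  by rewrite scalerDr scalerA mulrA.
- move=> _ [h Sh [t t0 ->]] /=.
  have Xk : X (h + t *: g) by apply: subspaceD => //; [exact: SX|exact: subspaceZ].
  split=> //; move: t0; rewrite le_eqVlt => /predU1P[t0|t0].
    by rewrite -{1}t0 mul0r p0.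
  (* For [t > 0], factoring out [t] leaves [g] minus an element of [S], where [p] is at least
     [d]. *)
  have -> : h + t *: g = t *: (g - (- t^-1) *: h).
    by rewrite scalerBr scaleNr scalerN opprK scalerA divff ?gt_eqF// scale1r addrC.
  have SZ : S (- t^-1 *: h) by exact: subspaceZ.
  rewrite (sublinearZ sX slp (ltW t0)) ?ler_pM2l//; first exact: dp.
  by apply: subspaceB => //; exact: SX.
have lge h : S h -> 0 <= l h.
  move=> Sh; have /lK : K (h, 0).
    by exists h => //; exists 0 => //; rewrite scale0r addr0 mul0r.
  exact.
exists l; split=> //.
  (* [S] also contains [- h], so nonnegativity on [S] forces vanishing. *)
  move=> h Sh; apply/eqP; rewrite eq_le lge// andbT.
  have := lge _ (subspaceN sS Sh); have := llin (-1) h 0 (SX _ Sh) sX.1.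
  have := llin (-1) 0 0 sX.1 sX.1; rewrite scaler0 scaleN1r !addr0; lra.
have /lK : K (g, d) by exists 0; [exact: sS.1|exists 1; rewrite ?scale1r ?mul1r ?add0r].
exact: lt_le_trans.
Qed.

End HahnBanach.

(** * Order continuous functionals on an ideal *)

Section OrderContinuous.
Set Implicit Arguments.
Unset Strict Implicit.
Context (d : measure_display) (T : measurableType d) (R : realType)
        (P : probability T R) (X : set (T -> R)).
Hypotheses (idealX : is_ideal P X) (cstX : forall c : R, X (fun _ => c)).
Implicit Types (x y f g : T -> R) (A B : set T) (phi psi : (T -> R) -> R).

Lemma ae_everywhere (Q : T -> Prop) : (forall t, Q t) -> {ae P, forall t, Q t}.
Proof. by move=> h; apply: filterS filterT => t _; exact: h. Qed.

Lemma ideal_measurable x : X x -> measurable_fun setT x.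
Proof. by case: idealX => + _ _ _ _; apply. Qed.

Lemma ideal_subspace : subspace X.
Proof.
case: idealX => _ X0 XD XZ _; split; first exact: X0.
by move=> a x y Xx Xy; apply: (XD (fun t => a * x t)) => //; exact: XZ.
Qed.

Lemma ideal_solid x y : X y -> measurable_fun setT x ->
  (forall t, `|x t| <= `|y t|) -> X x.
Proof.
case: idealX => _ _ _ _ XS Xy mx xy; apply: XS Xy mx _.
exact: ae_everywhere.
Qed.

Lemma ideal_indic A : measurable A -> X \1_A.
Proof.
move=> mA; apply: (ideal_solid (cstX 1)); first exact: measurable_indic.
by move=> t; rewrite indicE normr1 ger0_norm// lern1; case: (_ \in _).
Qed.

Lemma ideal_norm x : X x -> X (fun t => `|x t|).
Proof.
move=> Xx; apply: (ideal_solid Xx); last by move=> t; rewrite normr_id.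
exact: measurableT_comp (ideal_measurable Xx).
Qed.

Lemma ideal_max0 x : X x -> X (fun t => Num.max (x t) 0).
Proof.
move=> Xx; apply: (ideal_solid Xx).
  by apply: measurable_maxr => //; exact: ideal_measurable.
by move=> t; rewrite /Num.max; case: ltP => // _; rewrite normr0.
Qed.

(** * Algebra of linear functionals on the ideal *)

Section Linear.
Variable phi : (T -> R) -> R.
Hypothesis linphi : lin_functional P X phi.

Lemma lin_functionalP (a : R) x y : X x -> X y ->
  phi (a *: x + y) = a * phi x + phi y.
Proof. exact: linphi.2. Qed.

Lemma lin_functional0 : phi 0 = 0.
Proof.
have X0 := ideal_subspace.1.
by have := lin_functionalP (-1) X0 X0; rewrite scaler0 addr0 mulN1r addNr.
Qed.

Lemma lin_functionalZ (a : R) x : X x -> phi (a *: x) = a * phi x.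
Proof.
move=> Xx; rewrite -[a *: x]addr0 lin_functionalP//; last exact: ideal_subspace.1.
by rewrite lin_functional0 addr0.
Qed.

Lemma lin_functionalD x y : X x -> X y -> phi (x + y) = phi x + phi y.
Proof.
by move=> Xx Xy; rewrite -{1}[x]scale1r lin_functionalP// mul1r.
Qed.

Lemma lin_functionalB x y : X x -> X y -> phi (x - y) = phi x - phi y.
Proof.
move=> Xx Xy; rewrite addrC -scaleN1r lin_functionalP// mulN1r.
by rewrite addrC.
Qed.

End Linear.

(** * Monotone convergence and combinations of order continuous functionals *)

(** [x - u n] decreases to zero in [X] and serves as its own dominating net, so order continuity
    applies to it. *)
Lemma order_continuous_nd phi (u : nat -> T -> R) x : in_Xn P X phi ->
  (forall n, X (u n)) -> X x ->
  (forall t, {homo u^~ t : m n / (m <= n)%N >-> m <= n}) ->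
  (forall t, u^~ t @ \oo --> x t) ->
  (fun n => phi (u n)) @ \oo --> phi x.
Proof.
move=> [linphi ocphi] Xu Xx ndu ux.
have dleq : directed leq.
  split; [exact: (inhabits 0%N)|by []|by move=> a b c; exact: leq_trans|].
  by move=> a b; exists (maxn a b); rewrite leq_maxl leq_maxr.
have Xxu n : X (x - u n) by apply: subspaceB; [exact: ideal_subspace| |].
have ux_le t n : u n t <= x t.
  rewrite -(cvg_lim (@Rhausdorff R) (ux t)).
  by apply: nondecreasing_cvgn_le; [exact: ndu|apply/cvg_ex; exists (x t); exact: ux].
apply/cvgrPdist_lt => e e0.
have [|||n0 Hn0] := ocphi nat leq (fun n => x - u n) _ _ _ e e0 => //.
  exists nat, leq, (fun n => x - u n); split => //.
    split => //.
    - move=> a b ab; apply: ae_everywhere => t.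
      by rewrite /= lerD2l lerN2; exact: ndu.
    - by move=> b; apply: ae_everywhere => t /=; rewrite subr_ge0.
    (* The index set is countable, so the exceptional null sets merge into one and the limit can be
       taken pointwise. *)
    - move=> w Xw wxu; apply: filterS (ae_foralln wxu) => t wt.
      have : (fun n => x t - u n t) @ \oo --> (0 : R).
        rewrite -(subrr (x t)); apply: cvgB; [exact: cvg_cst|exact: ux].
      move=> cv0; rewrite -(cvg_lim (@Rhausdorff R) cv0).
      apply: limr_ge; first by apply/cvg_ex; exists 0.
      by apply: nearW => n; exact: wt.
  move=> b; exists b => a ab; apply: ae_everywhere => t /=.
  by rewrite subr0 ger0_norm ?subr_ge0// lerD2l lerN2; exact: ndu.
exists n0 => // n /= n0n.
by have := Hn0 n n0n; rewrite lin_functionalB.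
Qed.

(** Provides the combinations [psi - psi s * phi] needed when projecting along a vector [s]. *)
Lemma in_XnL (a : R) phi psi : in_Xn P X phi -> in_Xn P X psi ->
  in_Xn P X (fun x => a * phi x + psi x).
Proof.
move=> [lphi ophi] [lpsi opsi]; split.
  split=> [x y Xx Xy xy|b x y Xx Xy].
    by rewrite (lphi.1 _ _ Xx Xy xy) (lpsi.1 _ _ Xx Xy xy).
  by rewrite lphi.2// lpsi.2//; ring.
move=> A le xs dle Xxs cxs e e0.
(* The shift by 1 keeps the divisor positive when [a = 0]. *)
have a1 : 0 < `|a| + 1 by rewrite ltr_wpDl.
have [|n1 H1] := ophi A le xs dle Xxs cxs (e / 2 / (`|a| + 1)).
  by rewrite !divr_gt0.
have [|n2 H2] := opsi A le xs dle Xxs cxs (e / 2).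
  by rewrite divr_gt0.
case: dle => _ _ letr /(_ n1 n2)[n [n1n n2n]].
exists n => m nm; rewrite (splitr e).
apply: le_lt_trans (ler_normD _ _) _; apply: ltr_leD; last first.
  by apply: ltW; apply: H2; exact: letr nm.
rewrite normrM.
have := H1 m (letr _ _ _ n1n nm); rewrite ltr_pdivlMr// => h.
by apply: le_lt_trans h; rewrite mulrC ler_wpM2l// lerDl.
Qed.


(** * The span O_f and the generators of sigma(f) *)

Lemma Of_subspace f : subspace (Of f).
Proof.
split; first by exists 0, [::] => t; rewrite big_nil addr0.
move=> a x y [c [s xs]] [e [r yr]].
exists (a * c + e), ([seq (a * p.1, p.2) | p <- s] ++ r) => t.
transitivity (a * x t + y t) => //.
rewrite xs yr big_cat big_map /= mulrDr addrACA; congr (_ + (_ + _)).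
by rewrite mulr_sumr; apply: eq_bigr => p _; rewrite mulrA.
Qed.

Lemma Of_cst f (c : R) : Of f (fun _ => c).
Proof. by exists c, [::] => t; rewrite big_nil addr0. Qed.

Lemma Of_hinge f (k : R) : Of f (fun t => Num.max (f t - k) 0).
Proof. by exists 0, [:: (1, k)] => t; rewrite big_seq1 mul1r add0r. Qed.

Lemma ideal_hinge f (k : R) : X f -> X (fun t => Num.max (f t - k) 0).
Proof.
move=> Xf; apply: ideal_max0.
exact: (subspaceB ideal_subspace Xf (cstX k)).
Qed.

Lemma Of_ideal f : X f -> Of f `<=` X.
Proof.
move=> Xf h [c [s hs]]; have sX := ideal_subspace.
have -> : h = (fun=> c) + \sum_(p <- s) p.1 *: (fun t => Num.max (f t - p.2) 0).
  apply/funext => t; rewrite hs fctE fct_sumE.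
  by congr (_ + _); apply: eq_bigr.
apply: (subspaceD sX) => //; elim: s {hs} => [|p s IHs].
  by rewrite big_nil; exact: sX.1.
rewrite big_cons; apply: (subspaceD sX) => //.
by apply: (subspaceZ _ sX); exact: ideal_hinge.
Qed.

(** Names the generators of [sigma_f], so that the sigma-algebra can serve as a measurable type. *)
Definition sigma_f_gen f := [set A |
  (exists B : set R, measurable B /\ A = f @^-1` B) \/
  (measurable A /\ P A = 0%E)].

(** The left side is visibly a combination of hinges; the right side is visibly nondecreasing in [m]
    and tends to the indicator of [s > 0]. *)
Let hinge_quotient (m s : R) : 0 < m ->
  m * (Num.max s 0 - Num.max (s - m^-1) 0) = Num.min (m * Num.max s 0) 1.
Proof.
move=> m0; have mV : m * m^-1 = 1 by rewrite divff ?gt_eqF.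
have mV0 : 0 < m^-1 by rewrite invr_gt0.
have [s0|s0] := leP s 0.
  rewrite max_r; last by lra.
  by rewrite subrr mulr0 min_l.
have [h|h] := leP s m^-1.
  rewrite max_r ?subr_le0// subr0 min_l// -mV ler_wpM2l//; exact: ltW.
rewrite max_l; last by lra.
rewrite min_r; first by rewrite opprB addrC subrK mV.
by rewrite -mV ler_wpM2l// ltW.
Qed.

(** * Functionals annihilating O_f *)

Section Annihilator.
Variables (f : T -> R) (phi : (T -> R) -> R).
Hypotheses (Xf : X f) (Xnphi : in_Xn P X phi).
Hypothesis phi_Of : forall h, Of f h -> phi h = 0.

Let sX := ideal_subspace.
Let linphi : lin_functional P X phi := Xnphi.1.
Let mf : measurable_fun setT f := ideal_measurable Xf.

(* [1_{f > a}] is the increasing limit of [n ((f - a)^+ - (f - a - 1/n)^+)],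
   the latter being [min (n (f - a)^+) 1]. *)
Lemma annihilator_superlevel (a : R) : phi \1_[set t | a < f t] = 0.
Proof.
pose A := [set t | a < f t].
have mA : measurable A.
  by rewrite -[A]setTI; exact: measurable_fun_ltr.
pose u n : T -> R := n.+1%:R *:
  ((fun t => Num.max (f t - a) 0) - (fun t => Num.max (f t - (a + n.+1%:R^-1)) 0)).
have uE n t : u n t = Num.min (n.+1%:R * Num.max (f t - a) 0) 1.
  by rewrite -hinge_quotient// -addrA -opprD.
have Ou n : Of f (u n).
  apply: subspaceZ; first exact: Of_subspace.
  by apply: subspaceB; [exact: Of_subspace|exact: Of_hinge..].
have cvu : (fun n => phi (u n)) @ \oo --> phi \1_A.
  apply: order_continuous_nd => //.
  - by move=> n; exact: Of_ideal (Ou n).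
  - exact: ideal_indic.
  - move=> t m n mn; rewrite !uE le_min ge_min ge_min lexx !orbT andbT.
    by rewrite ler_wpM2r ?ler_nat ?ltnS// le_max lexx orbT.
  - move=> t; have [fa|fa] := leP (f t) a.
      rewrite indicE memNset/=; last by rewrite /A/=; apply/negP; rewrite -leNgt.
      under eq_fun do rewrite uE max_r ?subr_le0// mulr0 min_l//.
      exact: cvg_cst.
    rewrite indicE mem_set//=; apply: cvg_near_cst.
    (* From this rank on the slope [n + 1] exceeds [1 / (f t - a)], and the ramp has reached 1. *)
    exists (Num.truncn (f t - a)^-1) => // n /= hn.
    have fa0 : 0 < f t - a by rewrite subr_gt0.
    rewrite uE max_l ?subr_ge0 ?ltW//.
    rewrite min_r// -ler_pdivrMr// div1r ltW//.
    by apply: lt_le_trans (truncnS_gt _) _; rewrite ler_nat ltnS.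
rewrite -(cvg_lim (@Rhausdorff R) cvu).
by under eq_fun do rewrite phi_Of//; rewrite lim_cst.
Qed.

(** Superlevel sets and null sets together form a pi-system generating sigma(f); the sets whose
    indicator [phi] kills form a lambda-system. *)
Lemma annihilator_sigma_f A : sigma_f P f A -> measurable A /\ phi \1_A = 0.
Proof.
pose Pi := [set A | (exists a : R, A = [set t | a < f t]) \/
                    (measurable A /\ P A = 0%E)].
pose H := [set A | measurable A /\ phi \1_A = 0].
have msup (a : R) : measurable [set t | a < f t].
  by rewrite -[[set t | _]]setTI; exact: measurable_fun_ltr.
have mPi B : Pi B -> measurable B by move=> [[a ->]|[]].
have PiI : setI_closed Pi.
  have null B C : measurable B -> measurable C -> P B = 0%E ->
      measurable (B `&` C) /\ P (B `&` C) = 0%E.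
    move=> mB mC PB; split; first exact: measurableI.
    by apply: (subset_measure0 _ _ _ PB) => //; exact: measurableI.
  move=> B C PiB PiC; have mB := mPi _ PiB; have mC := mPi _ PiC.
  case: PiB => [[a Ba]|[_ PB]]; last by right; exact: null.
  case: PiC => [[b Cb]|[_ PC]]; last by right; rewrite setIC; exact: null.
  left; exists (Num.max a b); rewrite Ba Cb.
  apply/seteqP; split=> t /=; rewrite gt_max; first by move=> [-> ->].
  by move=> /andP[].
have PiH : Pi `<=` H.
  move=> B PiB; split; first exact: mPi.
  case: PiB => [[a ->]|[mB PB]]; first exact: annihilator_superlevel.
  rewrite -(lin_functional0 linphi); apply: linphi.1; [exact: ideal_indic|exact: sX.1|].
  exists B; split=> // t /= Bt; apply: contrapT => nBt; apply: Bt.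
  by rewrite indicE memNset.
(* Constants of O_f give the whole space, linearity the proper differences, order continuity the
   increasing unions. *)
have lH : lambda_system setT H.
  split=> //.
  - by split=> //; rewrite indicT; apply: phi_Of; exact: Of_cst.
  - move=> B C CB [mB B0] [mC C0]; split; first exact: measurableD.
    have -> : \1_(B `\` C) = \1_B - \1_C :> (T -> R).
      apply/funext => t; rewrite !fctE !indicE in_setD.
      have [tC|tC] := boolP (t \in C).
        by rewrite (mem_set (CB _ (set_mem tC))) subrr.
      by rewrite andbT subr0.
    by rewrite lin_functionalB ?B0 ?C0 ?subrr//; exact: ideal_indic.
  - move=> F ndF HF; have mF n := (HF n).1.
    have mUF : measurable (\bigcup_i F i) by exact: bigcup_measurable.
    split=> //.
    have cvF : (fun n => phi (\1_(F n))) @ \oo --> phi \1_(\bigcup_i F i).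
      apply: order_continuous_nd => //.
      + by move=> n; exact: ideal_indic.
      + exact: ideal_indic.
      + move=> t m n mn; rewrite !indicE ler_nat.
        have [tF|//] := boolP (t \in F m).
        rewrite mem_set//; move/ndF: mn => /subsetPset; apply.
        exact: set_mem tF.
      + move=> t; have [[n _ Fnt]|nF] := pselect ((\bigcup_i F i) t).
          apply: cvg_near_cst; exists n => // m /= nm.
          rewrite !indicE !mem_set//; first by exists n.
          by move/ndF: nm => /subsetPset; apply.
        rewrite indicE memNset//; apply: cvg_near_cst; apply: nearW => n.
        by rewrite indicE memNset// => Fnt; apply: nF; exists n.
    rewrite -(cvg_lim (@Rhausdorff R) cvF).
    by under eq_fun do rewrite (HF _).2; rewrite lim_cst.
have sPi : <<s Pi >> `<=` H by exact: (lambda_system_subset PiI lH PiH).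
suff sub : sigma_f P f `<=` <<s Pi >> by move=> /sub/sPi.
apply: smallest_sub; first exact: smallest_sigma_algebra.
move=> C [[B [mB ->]]|null]; last by apply: sub_sigma_algebra; right.
(* Open half-lines generate the Borel sets, so superlevel sets generate all preimages under [f]. *)
have mfPi : measurable_fun [set: g_sigma_algebraType Pi] f.
  apply: (measurability _ (RGenOInfty.measurableE R)) => _ [_ [a ->] <-].
  rewrite setTI; apply: sub_sigma_algebra; left; exists a.
  by apply/seteqP; split => t /=; rewrite in_itv/= andbT.
by have := mfPi measurableT B mB; rewrite setTI.
Qed.


Import HBNNSimple.

(** A simple function is a finite combination of indicators of its fibres. Membership in [X] is
    carried through the induction because [phi] is linear only on [X]. *)
Lemma annihilator_simple (s : {nnsfun g_sigma_algebraType (sigma_f_gen f) >-> R}) :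
  X s /\ phi s = 0.
Proof.
have ms (y : R) : sigma_f P f (s @^-1` [set y]).
  exact: (measurable_funPTI s (measurable_set1 y)).
have sE : (s : T -> R) =
    \sum_(y <- finmap.enum_fset (fset_set (range s)))
      y *: (\1_(s @^-1` [set y]) : T -> R).
  by apply/funext => t; rewrite fct_sumE (fimfunE s t) fsbig_finite.
rewrite sE; elim: (X in \sum_(y <- X) _) => [|y r [Xr phir]].
  by rewrite big_nil lin_functional0//; split=> //; exact: sX.1.
have [mA phiA] := annihilator_sigma_f (ms y).
have XA := ideal_indic mA.
rewrite big_cons lin_functionalP// phir phiA mulr0 addr0; split=> //.
exact: sX.2.
Qed.

(** Monotone approximation by simple functions measurable for sigma(f) itself, hence killed by
    [phi]. *)
Lemma annihilator_ge0 g : X g -> sigma_f_measurable P f g ->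
  (forall t, 0 <= g t) -> phi g = 0.
Proof.
move=> Xg mg g0.
have mEg : measurable_fun [set: g_sigma_algebraType (sigma_f_gen f)] (EFin \o g).
  by apply/measurable_EFinP => _ B mB; rewrite setTI; exact: mg.
pose s n := nnsfun_approx measurableT mEg n.
have sg t : (fun n => s n t) @ \oo --> g t.
  have /fine_cvgP[_] := cvg_nnsfun_approx measurableT mEg (fun t _ => g0 t) (x:=t) I.
  exact.
have cvs : (fun n => phi (s n)) @ \oo --> phi g.
  apply: order_continuous_nd => //.
  - by move=> n; exact: (annihilator_simple (s n)).1.
  - by move=> t m n mn; have /lefP := nd_nnsfun_approx measurableT mEg mn; exact.
rewrite -(cvg_lim (@Rhausdorff R) cvs).
by under eq_fun do rewrite (annihilator_simple (s _)).2; rewrite lim_cst.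
Qed.

(** The positive and negative parts of [g] stay in [X] and remain measurable for sigma(f). *)
Lemma annihilator_measurable g : X g -> sigma_f_measurable P f g -> phi g = 0.
Proof.
move=> Xg mg.
have mTg : measurable_fun [set: g_sigma_algebraType (sigma_f_gen f)] g.
  by move=> _ B mB; rewrite setTI; exact: mg.
have posX h : X h -> X h^\+ by exact: ideal_max0.
have Xgn : X g^\- by rewrite -funrposN; apply: posX; exact: (subspaceN sX).
have mpos (B : set R) : measurable B -> sigma_f P f (g^\+ @^-1` B).
  by move=> mB; have := measurable_funrpos mTg measurableT mB; rewrite setTI.
have mneg (B : set R) : measurable B -> sigma_f P f (g^\- @^-1` B).
  by move=> mB; have := measurable_funrneg mTg measurableT mB; rewrite setTI.
rewrite -(funrposBneg g) lin_functionalB//; last exact: posX.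
by rewrite !annihilator_ge0 ?subrr//; exact: posX.
Qed.

End Annihilator.

(* Induction on the functionals: either the first one annihilates [S], hence
   [g], or [S] and [g] can be projected onto its kernel along a vector of [S]. *)
Lemma finite_interpolation (S : set (T -> R)) g : subspace S -> S `<=` X -> X g ->
  (forall psi, in_Xn P X psi -> (forall h, S h -> psi h = 0) -> psi g = 0) ->
  forall phis : seq ((T -> R) -> R), (forall phi, phi \in phis -> in_Xn P X phi) ->
  exists h, S h /\ forall phi, phi \in phis -> phi h = phi g.
Proof.
move=> + + + + phis; elim: phis S g => [|phi l IHl] S g sS SX Xg ann Xnl.
  by exists 0; split=> //; exact: sS.1.
have sX := ideal_subspace.
have Xnphi : in_Xn P X phi by apply: Xnl; rewrite mem_head.
have {}Xnl psi : psi \in l -> in_Xn P X psi.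
  by move=> psil; apply: Xnl; rewrite in_cons psil orbT.
have [phiS|/existsNP[s0 /not_implyP[Ss0 /eqP phis0]]] :=
    pselect (forall h, S h -> phi h = 0).
  have [h [Sh hl]] := IHl S g sS SX Xg ann Xnl.
  exists h; split=> // psi; rewrite in_cons => /predU1P[->|]; last exact: hl.
  by rewrite phiS// ann.
(* Normalised so that [x - phi x *: s] is a projection onto the kernel of [phi]. *)
pose s := (phi s0)^-1 *: s0.
have Ss : S s by exact: subspaceZ.
have Xs := SX _ Ss.
have phis : phi s = 1 by rewrite (lin_functionalZ Xnphi.1) ?mulVf//; exact: SX.
have proj psi x : in_Xn P X psi -> X x ->
    psi (x - phi x *: s) = psi x - phi x * psi s.
  move=> [lpsi _] Xx; rewrite (lin_functionalB lpsi)//; last exact: (subspaceZ _ sX).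
  by rewrite (lin_functionalZ lpsi).
have [|||||h [[Sh phih] hl]] := IHl [set x | S x /\ phi x = 0] (g - phi g *: s).
- split; first by split; [exact: sS.1|exact: lin_functional0 Xnphi.1].
  move=> a x y [Sx phix] [Sy phiy]; split; first exact: sS.2.
  by rewrite (lin_functionalP Xnphi.1) ?phix ?phiy ?mulr0 ?addr0//; exact: SX.
- by move=> x [Sx _]; exact: SX.
- by apply: (subspaceB sX) => //; exact: (subspaceZ _ sX).
- move=> psi Xnpsi psi0; rewrite proj//.
  (* [psi - psi s * phi] annihilates [S], hence [g]; its value at [g] is that of [psi] at the
     projected [g]. *)
  have := ann _ (in_XnL (- psi s) Xnphi Xnpsi); rewrite mulNr addrC mulrC; apply.
  move=> x Sx; have Xx := SX _ Sx.
  have : psi (x - phi x *: s) = 0.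
    apply: psi0; split; last by rewrite proj// phis mulr1 subrr.
    by apply: (subspaceB sS) => //; exact: (subspaceZ _ sS).
  by rewrite proj// => <-; ring.
- exact: Xnl.
have XgN : X (phi g *: s) by exact: (subspaceZ _ sX).
have Xh := SX _ Sh.
(* Adding [phi g *: s] undoes the projection of [g]. *)
exists (h + phi g *: s); split.
  by apply: (subspaceD sS) => //; exact: (subspaceZ _ sS).
move=> psi; rewrite in_cons => /predU1P[->|psil].
  by rewrite (lin_functionalD Xnphi.1)// phih (lin_functionalZ Xnphi.1)// phis
    add0r mulr1.
have Xnpsi := Xnl _ psil.
by rewrite (lin_functionalD Xnpsi.1)// hl// proj// (lin_functionalZ Xnpsi.1 _ Xs) subrK.
Qed.

(** Interpolation is exact, so the difference is zero whatever [e] is. *)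
Lemma measurable_weak_closure f g : X f -> X g -> sigma_f_measurable P f g ->
  weak_closure P X (Of f) g.
Proof.
move=> Xf Xg mg; split=> // phis e Xnphis e0.
have [|h [Oh hphi]] :=
  finite_interpolation (Of_subspace f) (Of_ideal Xf) Xg _ Xnphis.
  by move=> psi Xnpsi psiO; exact: annihilator_measurable mg.
by exists h; split=> // phi phiphis; rewrite hphi// subrr normr0.
Qed.

(** * Strictly positive functionals *)

Section StrictlyPositive.
Variable phi : (T -> R) -> R.
Hypotheses (Xnphi : in_Xn P X phi) (posphi : strictly_positive P X phi).

Let sX := ideal_subspace.
Let linphi : lin_functional P X phi := Xnphi.1.

Lemma strictly_positive_ge0 x : X x -> (forall t, 0 <= x t) -> 0 <= phi x.
Proof.
(* Strict positivity is silent on an a.e. null [x], where invariance under a.e. equality gives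
   [phi x = 0]. *)
move=> Xx x0; have [x00|nx0] := pselect {ae P, forall t, x t = 0}.
  by rewrite (linphi.1 x 0)// ?(lin_functional0 linphi)//; exact: sX.1.
by apply/ltW/posphi => //; exact: ae_everywhere.
Qed.

Lemma strictly_positive_le x y : X x -> X y -> (forall t, x t <= y t) ->
  phi x <= phi y.
Proof.
move=> Xx Xy xy; rewrite -subr_ge0 -(lin_functionalB linphi)//.
apply: strictly_positive_ge0 => [|t]; first exact: subspaceB.
by rewrite subr_ge0.
Qed.

(** The L1-type seminorm attached to [phi]. *)
Let p x := phi (fun t => `|x t|).

Let sublinear_p : sublinear X p.
Proof.
split.
- by rewrite /p; under eq_fun do rewrite normr0; exact: lin_functional0 linphi.
- move=> a x a0 Xx; rewrite -(lin_functionalZ linphi)//; last exact: ideal_norm.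
  rewrite le_eqVlt; apply/orP; left; apply/eqP; congr phi; apply/funext => t.
  by rewrite fctE normrM gtr0_norm.
- move=> x y Xx Xy; have Xnx := ideal_norm Xx; have Xny := ideal_norm Xy.
  rewrite -(lin_functionalD linphi)//; apply: strictly_positive_le.
  + by apply: ideal_norm; exact: subspaceD.
  + exact: subspaceD Xnx Xny.
  + by move=> t; exact: ler_normD.
Qed.

(** The seminorm bounds [psi] in absolute value, so [psi] inherits a.e. invariance and order
    continuity from [phi]. This puts Hahn-Banach functionals in the order continuous dual. *)
Lemma dominated_in_Xn psi :
  (forall (a : R) x y, X x -> X y -> psi (a *: x + y) = a * psi x + psi y) ->
  (forall x, X x -> psi x <= phi (fun t => `|x t|)) -> in_Xn P X psi.
Proof.
move=> lpsi psip.
have psi0 : psi 0 = 0.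
  by have := lpsi (-1) 0 0 sX.1 sX.1; rewrite scaler0 addr0 mulN1r addNr.
have psiN x : X x -> psi (- x) = - psi x.
  by move=> Xx; have := lpsi (-1) x 0 Xx sX.1; rewrite scaleN1r !addr0 mulN1r psi0 addr0.
have psi_le x : X x -> `|psi x| <= p x.
  move=> Xx; rewrite ler_norml psip// andbT lerNl -psiN//.
  apply: le_trans (psip _ (subspaceN sX Xx)) _.
  by rewrite /p; under eq_fun do rewrite normrN.
split; first split.
- move=> x y Xx Xy xy; apply/eqP; rewrite -subr_eq0 -normr_le0.
  have Xxy : X (x - y) by exact: subspaceB.
  have -> : psi x - psi y = psi (x - y).
    by have := lpsi (-1) y x Xy Xx; rewrite scaleN1r mulN1r addrC => ->; rewrite addrC.
  apply: le_trans (psi_le _ Xxy) _.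
  rewrite /p (linphi.1 _ 0) ?(lin_functional0 linphi)//; [exact: ideal_norm|exact: sX.1|].
  by apply: filterS xy => t xyt; rewrite fctE /= xyt subrr normr0.
- exact: lpsi.
- move=> A le xs dle Xxs [B [leB [z [dB dz xz]]]] e e0.
  (* The moduli of [xs] are order null with the same dominating net [z]. *)
  have [||a0 Ha0] := Xnphi.2 A le (fun a t => `|xs a t|) dle _ _ e e0.
  + by move=> a; exact: ideal_norm.
  + exists B, leB, z; split=> // b; have [a0 Ha0] := xz b; exists a0 => a /Ha0.
    by apply: filterS => t; rewrite !subr0 normr_id.
  + exists a0 => a a0a; apply: le_lt_trans (psi_le _ (Xxs a)) _.
    exact: le_lt_trans (ler_norm _) (Ha0 a a0a).
Qed.

(** Otherwise [S] stays at seminorm distance at least [e] from [g], and a separating functional,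
    order continuous by domination, contradicts weak adherence. *)
Lemma weak_closure_approx (S : set (T -> R)) g (e : R) : subspace S -> S `<=` X ->
  weak_closure P X S g -> 0 < e ->
  exists h, S h /\ phi (fun t => `|g t - h t|) < e.
Proof.
move=> sS SX [Xg wg] e0; apply: contrapT => /forallNP nh.
have [|h Sh|psi [lpsi psip psiS psig]] :=
    @hahn_banach_separation R (T -> R) X p S g e sX sublinear_p sS SX Xg e0.
- move=> x Xx; apply: strictly_positive_ge0 => //; exact: ideal_norm.
- by rewrite leNgt; apply/negP => ?; apply: (nh h).
(* [psi] vanishes on [S], so the neighbourhood of [g] of radius [psi g] misses [S]. *)
have [|h [Sh]] := wg [:: psi] (psi g) _ psig.
  by move=> q; rewrite mem_seq1 => /eqP ->; exact: dominated_in_Xn.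
by move=> /(_ psi (mem_head _ _)); rewrite (psiS h)// subr0 gtr0_norm// ltxx.
Qed.

(* Markov's inequality for [phi] bounds [phi] on the indicator of
   [\sum_n |g - h_n| > M] by [1 / M], so the sum is finite almost everywhere. *)
Lemma approx_cvg_ae g (h : nat -> T -> R) : X g -> (forall n, X (h n)) ->
  (forall n, phi (fun t => `|g t - h n t|) <= 2^-1 ^+ n.+1) ->
  {ae P, forall t, (fun n => h n t) @ \oo --> g t}.
Proof.
move=> Xg Xh hg.
pose x n : T -> R := fun t => `|g t - h n t|.
have Xx n : X (x n) by apply: ideal_norm; exact: (subspaceB sX Xg (Xh n)).
pose y n : T -> R := fun t => series (x^~ t) n.
have y0 : y 0%N = 0 by apply/funext => t; rewrite /y /series /= big_geq.
have yS n : y n.+1 = y n + x n.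
  by apply/funext => t; rewrite /y /series /= big_nat_recr.
have ndy t : {homo y^~ t : m n / (m <= n)%N >-> m <= n}.
  by apply/nondecreasing_seqP => n; rewrite yS fctE lerDl; exact: normr_ge0.
have Xy n : X (y n).
  elim: n => [|n IHn]; first by rewrite y0; exact: sX.1.
  by rewrite yS; exact: subspaceD.
(* The right side is the sum of the first [n] error bounds. *)
have phiy n : phi (y n) <= 1 - 2^-1 ^+ n.
  elim: n => [|n IHn]; first by rewrite y0 (lin_functional0 linphi)// expr0 subrr.
  rewrite yS (lin_functionalD linphi)//; apply: le_trans (lerD IHn (hg n)) _.
  by rewrite exprS; lra.
have ygt0 n t : 0 <= y n t by apply: le_trans (ndy t _ _ (leq0n n)); rewrite y0.
pose A (M n : nat) := [set t | M%:R < y n t].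
have mA M n : measurable (A M n).
  rewrite -[A M n]setTI; apply: measurable_fun_ltr => //; exact: ideal_measurable.
have ndA M t : {homo (fun n => \1_(A M n) t : R) : m n / (m <= n)%N >-> m <= n}.
  move=> m n mn; rewrite !indicE ler_nat.
  have [/set_mem tA|//] := boolP (t \in A M m).
  by rewrite mem_set//; exact: lt_le_trans tA (ndy t _ _ mn).
pose U M := \bigcup_n A M n.
have mU M : measurable (U M) by exact: bigcup_measurable.
have phiU (M : nat) : M%:R * phi \1_(U M) <= 1.
  have cvU : (fun n => phi \1_(A M n)) @ \oo --> phi \1_(U M).
    apply: order_continuous_nd => //.
    - by move=> n; exact: ideal_indic.
    - exact: ideal_indic.
    - move=> t; have [[n _ Ant]|nU] := pselect (U M t).
        apply: cvg_near_cst; exists n => // m /= nm.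
        rewrite !indicE !mem_set//; first by exists n.
        exact: lt_le_trans Ant (ndy t _ _ nm).
      rewrite indicE memNset//; apply: cvg_near_cst; apply: nearW => n.
      by rewrite indicE memNset// => Ant; apply: nU; exists n.
  have cvMU : (fun n => M%:R * phi \1_(A M n)) @ \oo --> M%:R * phi \1_(U M).
    by apply: cvgM => //; exact: cvg_cst.
  rewrite -(cvg_lim (@Rhausdorff R) cvMU).
  apply: limr_le; first by apply/cvg_ex; exists (M%:R * phi \1_(U M)).
  apply: nearW => n; have XA : X \1_(A M n) by exact: ideal_indic.
  rewrite -(lin_functionalZ linphi)//.
  apply: (@le_trans _ _ (phi (y n))); last first.
    by apply: le_trans (phiy n) _; rewrite gerBl exprn_ge0// invr_ge0.
  apply: strictly_positive_le => //; first exact: subspaceZ.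
  move=> t; rewrite fctE indicE; have [/set_mem tA|_] := boolP (t \in A M n).
    by rewrite /GRing.scale /= mulr1 ltW.
  by rewrite scaler0.
(* [N] is the set where the partial sums are unbounded. *)
pose N := \bigcap_M U M.
have mN : measurable N by exact: bigcap_measurable.
have XN : X \1_N by exact: ideal_indic.
have phiN : phi \1_N <= 0.
  rewrite leNgt; apply/negP => phiN0.
  (* An integer above the inverse of [phi \1_N] contradicts [phiU], since [N] lies in every
     [U M]. *)
  have := truncnS_gt (phi \1_N)^-1; rewrite ltNge => /negP; apply.
  rewrite -[leRHS]div1r ler_pdivlMr//; apply: le_trans (phiU (Num.truncn _).+1).
  apply: ler_wpM2l => //; apply: strictly_positive_le => //; first exact: ideal_indic.
  move=> t; rewrite !indicE ler_nat; have [/set_mem tN|//] := boolP (t \in N).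
  by rewrite mem_set//; exact: tN.
have : {ae P, forall t, \1_N t = 0 :> R}.
  apply: contrapT => nN; have := posphi XN _ nN; rewrite ltNge phiN => h1.
  by have : false by apply: h1; apply: ae_everywhere => t; rewrite indicE.
apply: filterS => t; rewrite indicE => tN.
have /existsNP[M nU] : ~ (forall M, U M t).
  by move=> tU; move: tN; rewrite mem_set//=; exact/eqP/oner_neq0.
(* Off [N] the nondecreasing partial sums are bounded, so the series converges and its terms tend to
   zero. *)
have cvy : cvgn (series (x^~ t)).
  apply: nondecreasing_is_cvgn; first exact: ndy.
  exists M%:R => _ [n _ <-]; rewrite leNgt; apply/negP => Mn.
  by apply: nU; exists n.
have /cvgr0_norm_lt x0 := cvg_series_cvg_0 cvy.
apply/cvgrPdist_lt => e e0; near=> n.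
by rewrite -normr_id; near: n; exact: x0.
Unshelve. all: by end_near.
Qed.

Lemma weak_closure_cvg_ae (S : set (T -> R)) g : subspace S -> S `<=` X ->
  weak_closure P X S g -> exists gs : nat -> T -> R, (forall n, S (gs n)) /\
    {ae P, forall t, (fun n => gs n t) @ \oo --> g t}.
Proof.
move=> sS SX wg.
have /choice[gs gsP] (n : nat) :
    exists h, S h /\ phi (fun t => `|g t - h t|) < 2^-1 ^+ n.+1.
  by apply: weak_closure_approx => //; rewrite exprn_gt0.
exists gs; split=> [n|]; first exact: (gsP n).1.
by apply: approx_cvg_ae => [|n|n]; [exact: wg.1|exact/SX/(gsP n).1|exact/ltW/(gsP n).2].
Qed.

End StrictlyPositive.

(** * Almost everywhere limits of elements of O_f *)

(** Off a null set [N], [g] is a pointwise limit of functions measurable for sigma(f), and every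
    measurable subset of [N] lies in sigma(f). *)
Lemma cvg_ae_sigma_f_measurable f g (gs : nat -> T -> R) : X g ->
  (forall n, Of f (gs n)) ->
  {ae P, forall t, (fun n => gs n t) @ \oo --> g t} ->
  sigma_f_measurable P f g.
Proof.
move=> Xg Ogs [N [mN PN cvN]] B mB.
pose G := sigma_f_gen f.
have null A : measurable A -> A `<=` N -> sigma_f P f A.
  move=> mA AN; apply: sub_sigma_algebra; right; split=> //.
  exact: subset_measure0 PN.
have mf : measurable_fun [set: g_sigma_algebraType G] f.
  by move=> _ C mC; rewrite setTI; apply: sub_sigma_algebra; left; exists C.
have mOf h : Of f h -> measurable_fun [set: g_sigma_algebraType G] h.
  move=> [c [s hs]].
  have -> : h = (fun t => c + \sum_(p <- s) p.1 * Num.max (f t - p.2) 0).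
    exact/funext.
  apply: measurable_funD => //; apply: measurable_sum => p.
  apply: measurable_funM => //; apply: measurable_maxr => //.
  exact: measurable_funB.
have mNC : measurable (~` N : set (g_sigma_algebraType G)).
  by apply: measurableC; exact: null.
(* Cutting off on [N] makes the convergence hold everywhere. *)
pose g0 t := g t * \1_(~` N) t.
have mg0 : measurable_fun [set: g_sigma_algebraType G] g0.
  apply: (@measurable_fun_cvg _ (g_sigma_algebraType G) R setT
    (fun n t => gs n t * \1_(~` N) t)).
    by move=> n; apply: measurable_funM; [exact: mOf|exact: measurable_indic].
  move=> t _; have [tN|tN] := pselect (N t).
    rewrite /g0 indicE memNset; last by move/(_ tN).
    by under eq_fun do rewrite mulr0; rewrite mulr0; exact: cvg_cst.
  apply: cvgM; last exact: cvg_cst.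
  by apply: contrapT => ncv; apply/tN/cvN.
(* The preimages under [g] and [g0] differ only inside [N]; the piece in [N] is measurable because
   [g] is, hence a null set of sigma(f). *)
have -> : g @^-1` B = (g0 @^-1` B `\` N) `|` (g @^-1` B `&` N).
  apply/seteqP; split=> t /=; rewrite /g0.
    move=> Bgt; have [tN|tN] := pselect (N t); [by right|left].
    by rewrite indicE mem_set// mulr1.
  move=> [[+ tN]|[]//]; by rewrite indicE mem_set// mulr1.
have mg := ideal_measurable Xg.
apply: (@measurableU _ (g_sigma_algebraType G)).
  apply: measurableD; last exact: null.
  by rewrite -[X in measurable X]setTI; exact: mg0.
apply: null; last by move=> t [].
by apply: measurableI => //; rewrite -[X in measurable X]setTI; exact: mg.
Qed.

End OrderContinuous.

(** * The cycle of implications (a), (b), (c), (a) *)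

Theorem theorem3p1 (d : measure_display) (T : measurableType d) (R : realType)
  (P : probability T R) (X : set (T -> R)) :
  is_ideal P X ->
  (forall c : R, X (fun _ => c)) ->
  (exists phi, in_Xn P X phi /\ strictly_positive P X phi) ->
  forall f : T -> R, X f -> {ae P, forall t, 0 <= f t} ->
  forall g : T -> R, X g ->
  ((sigma_f_measurable P f g /\ X g) <-> weak_closure P X (Of f) g) /\
  (weak_closure P X (Of f) g <->
     exists gs : nat -> T -> R, (forall n, Of f (gs n)) /\
       {ae P, forall t, (fun n => gs n t) @ \oo --> g t}).
Proof.
move=> idealX cstX [phi [Xnphi posphi]] f Xf _ g Xg.
have ab : sigma_f_measurable P f g -> weak_closure P X (Of f) g.
  exact: measurable_weak_closure idealX cstX _ _ Xf Xg.
have bc : weak_closure P X (Of f) g -> exists gs : nat -> T -> R,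
    (forall n, Of f (gs n)) /\ {ae P, forall t, (fun n => gs n t) @ \oo --> g t}.
  exact: weak_closure_cvg_ae idealX cstX _ Xnphi posphi _ _ (Of_subspace f)
    (Of_ideal idealX cstX Xf).
have ca gs : (forall n, Of f (gs n)) ->
    {ae P, forall t, (fun n => gs n t) @ \oo --> g t} -> sigma_f_measurable P f g.
  exact: cvg_ae_sigma_f_measurable idealX _ _ _ Xg.
split; split.
- by case=> /ab.
- by move=> /bc[gs [Ogs cvgs]]; split=> //; exact: ca cvgs.
- exact: bc.
- by move=> [gs [Ogs cvgs]]; apply: ab; exact: ca cvgs.
Qed.
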